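(* There is a function $f$ of the positive integer $\Delta$ satisfying (1) $f(\Delta)/\Delta\to\beta$ as $\Delta\to\infty$, where $\beta$ satisfies $\tfrac1\beta e^{1/\beta}=1$; (2) $f(\Delta)\le\lceil 11\Delta/6\rceil$ for $\Delta\ge14$; (3) $f(\Delta)<\lceil 11\Delta/6\rceil$ for $\Delta\ge31$; (4) in particular $f(22)=40<\lceil 11\cdot 22/6\rceil$; such that the following holds. Let $G=(V,E)$ be a bipartite graph with $n$ vertices and maximum degree $\Delta$. If $q>f(\Delta)$, then the mixing times of the Markov chains SCAN and MULTICOLOUR on $q$-colourings of $G$ are $O(\log n)$.
   Context: $G=(V,E)$ has bipartition $V_1,V_2$; $Q=\{1,\dots,q\}$ is the set of colours, and a colouring is a map $X:V\to Q$, not necessarily proper. $\mathcal{N}(v)$ is the set of neighbours of $v$, and $C(v)=\{X(w):w\in\mathcal{N}(v)\}$ is the set of colours occurring in the neighbourhood of $v$ in the current colouring $X$. To (heat bath) recolour a vertex $v$ means to choose a colour $q(v)\in Q\setminus C(v)$ uniformly at random (independently of all other choices) and give $v$ the colour $q(v)$. One step of MULTICOLOUR: choose $r\in\{1,2\}$ uniformly at random; recolour every vertex of $V_r$; then recolour every vertex of $V\setminus V_r$ (with $C(v)$ computed from the updated colours). One step of SCAN: recolour every vertex of $V_1$, then recolour every vertex of $V_2$ (so the sides are recoloured in the deterministic order $(V_1,V_2),(V_1,V_2),\dots$). Both chains have the uniform distribution on proper $q$-colourings of $G$ as equilibrium distribution. The mixing time $\tau(\varepsilon)$ is the least $t$ (number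 of steps, where one step of MULTICOLOUR or of SCAN consists of recolouring every vertex of both sides $V_1$ and $V_2$ once, in the order prescribed by the chain) such that, from every starting state, the law of the chain at every time $t'\ge t$ is within total variation distance $\varepsilon$ of the equilibrium distribution. The $O(\cdot)$ is as $n\to\infty$, with $\Delta$, $q$ and the accuracy $\varepsilon\in(0,1)$ fixed. *)

(* Defs.v *)
(* MathComp, with the reals of MathComp-Analysis. *)
From HB Require Import structures.
From mathcomp Require Import all_boot all_order all_algebra.
From mathcomp Require Import all_classical all_reals all_analysis.

Set Implicit Arguments.
Unset Strict Implicit.
Unset Printing Implicit Defensive.

Import Order.TTheory GRing.Theory Num.Theory.
Local Open Scope ring_scope.

Section FiniteMarkovChains.
Variables (R : realType) (T : finType).
(* A transition kernel K gives the probability K x y of moving from x to y. *)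
Implicit Types (K L : T -> T -> R) (mu nu pi : T -> R).

(* One move of K followed by one move of L. *)
Definition comp_kernel K L : T -> T -> R :=
  fun x z => \sum_(y : T) K x y * L y z.

(* [iter_kernel K t x] is the law after t steps of the chain started at x. *)
Fixpoint iter_kernel K (t : nat) : T -> T -> R :=
  if t is s.+1 then comp_kernel (iter_kernel K s) K
  else fun x y => (x == y)%:R.

Definition tv_dist mu nu : R := 2^-1 * \sum_(x : T) `|mu x - nu x|.

Definition mixed_from K pi (eps : R) (t : nat) : Prop :=
  forall (x : T) (t' : nat), (t <= t')%N ->
    tv_dist (iter_kernel K t' x) pi <= eps.

Definition is_mixing_time K pi (eps : R) (t : nat) : Prop :=
  mixed_from K pi eps t /\
  forall s : nat, mixed_from K pi eps s -> (t <= s)%N.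

End FiniteMarkovChains.

Section Graphs.
Variables (V : finType) (e : rel V).

Definition simple_graph : Prop := symmetric e /\ irreflexive e.

Definition neighbours (v : V) : {set V} := [set w | e v w].

Definition max_degree : nat := \max_(v : V) #|neighbours v|.

Definition is_bipartition (V1 V2 : {set V}) : Prop :=
  [/\ V1 :|: V2 = [set: V], [disjoint V1 & V2] &
      forall u v : V, e u v ->
        (u \in V1) && (v \in V2) || (u \in V2) && (v \in V1)].

End Graphs.

Section Colourings.
Variables (R : realType) (V : finType) (e : rel V) (q : nat).

(* Not necessarily proper. *)
Definition colouring : finType := {ffun V -> 'I_q}.
Implicit Types (X Y : colouring) (S : {set V}).

Definition proper_colouring X : bool :=
  [forall u, forall v, e u v ==> (X u != X v)].

Definition uniform_proper (X : colouring) : R :=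
  if proper_colouring X then #|[set Y : colouring | proper_colouring Y]|%:R^-1
  else 0.

Definition nbr_colours X (v : V) : {set 'I_q} :=
  [set X w | w in neighbours e v].

(* Probability that heat-bath recolouring of v in X yields the colour c. *)
Definition recolour_vertex X (v : V) (c : 'I_q) : R :=
  if c \notin nbr_colours X v then #|~: nbr_colours X v|%:R^-1 else 0.

(* All vertices of S are recoloured independently, with C(v) computed from X.
   For S without internal edges (a side of a bipartition) this is the same as
   recolouring the vertices of S one at a time, in any order. *)
Definition recolour_set S (X Y : colouring) : R :=
  (\prod_(v in S) recolour_vertex X v (Y v)) *
  (\prod_(v in ~: S) (Y v == X v)%:R).

Definition scan (V1 V2 : {set V}) : colouring -> colouring -> R :=
  comp_kernel (recolour_set V1) (recolour_set V2).

Definition multicolour (V1 V2 : {set V}) (X Y : colouring) : R :=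
  2^-1 * comp_kernel (recolour_set V1) (recolour_set V2) X Y +
  2^-1 * comp_kernel (recolour_set V2) (recolour_set V1) X Y.

End Colourings.
Arguments uniform_proper R {V} e q X.
Arguments scan R {V} e q V1 V2 _ _.
Arguments multicolour R {V} e q V1 V2 X Y.

(* Main.v *)
Require Import Defs.
From HB Require Import structures.
From mathcomp Require Import all_boot all_order all_algebra.
From mathcomp Require Import all_classical all_reals all_analysis.
From mathcomp Require Import ring lra zify.

Set Implicit Arguments.
Unset Strict Implicit.
Unset Printing Implicit Defensive.

Import Order.TTheory GRing.Theory Num.Theory.
Import numFieldNormedType.Exports.
Local Open Scope ring_scope.

(** Why rapid mixing sets in near [q = beta * D], with [D] the maximum degree.

    If the colour of one vertex [i] is changed, a neighbour [u] recoloured next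
    feels it with probability at most [1 / A], where [A] is the number of colours
    left to [u] by its other neighbours ([tv_recolour_vertex]). In the worst case
    [A] is only about [q - D], which would require [q > 2 D]. But the other
    neighbours of [u] have just been recoloured independently, each with a law
    that charges no colour more than [1 / (q - D)], so [A] is random and
    concentrated around [q exp (- D / q)]; a half-step therefore multiplies a
    disagreement by about [(D / q) exp (D / q)], which is less than 1 as soon as
    [q / D > beta].

    The argument is run on functions. For an observable [g] of one side, [osc_le]
    bounds the effect on its mean of conditioning one colour while all the others
    stay random under any product law with the bound [1 / (q - D)] above.
    Replacing the factors of a product law one at a time ([Ex_diff_le]) reduces
    the comparison of two arbitrary laws of this type to that case, and gives
    the contraction of one half-step, [recolour_contracts], with the rate
    [D * E (1 / A)]. Since recolouring a side twice in a row amounts to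
    recolouring it once, a step of either chain contains at least one useful
    half-step ([sensitivity_le_round]). After [t + 1] steps the total variation
    distance to the stationary law is at most [n * rate ^ t] ([contracting_tv]),
    which is small after [O (log n)] steps.

    The rate is estimated in [Ex_inv_unused]. The mean of [A] is bounded below by
    convexity of the exponential, and the variance is at most [(q - 1) / 4] because
    the events that two different colours are unused are negatively correlated;
    a second order expansion of [1 / A] then bounds [E (1 / A)]. With
    [b exp b = 1], that is [beta = 1 / b], the rate is less than 1 for
    [q >= D / b + 4] when [D] is large, and the numerical inequality
    [exp (3 / 5) <= 11 / 6] shows the same for [q] about [11 D / 6], for all
    [D >= 14]. The function [threshold] combines these ranges. *)

(** * Product laws *)

Section ProductLaws.
Variables (R : realType) (V T : finType).
Implicit Types (p : T -> R) (lam : V -> T -> R) (g : {ffun V -> T} -> R)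
  (Z : {ffun V -> T}) (S : {set V}).

Definition is_law p := (forall x, 0 <= p x) /\ \sum_x p x = 1.

Definition dirac_law (a : T) : T -> R := fun x => (x == a)%:R.

Lemma dirac_lawP a : is_law (dirac_law a).
Proof.
split=> [x|]; first exact: ler0n.
rewrite (bigD1 a) //= /dirac_law eqxx big1 ?addr0 // => i /negPf ->.
by [].
Qed.

Lemma sum_dirac p a : \sum_k p k * dirac_law k a = p a.
Proof.
rewrite (bigD1 a) //= /dirac_law eqxx mulr1 big1 ?addr0 // => i ia.
by rewrite eq_sym (negPf ia) mulr0.
Qed.

(** The vertices of a side are recoloured independently, so what happens in a
    half-step is always a mean of this kind. *)
Definition Ex lam g : R := \sum_(Z : {ffun V -> T}) (\prod_v lam v (Z v)) * g Z.

Lemma eq_Ex lam lam' g g' :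
  (forall v x, lam v x = lam' v x) -> g =1 g' -> Ex lam g = Ex lam' g'.
Proof.
move=> e1 e2; apply: eq_bigr => Z _; rewrite e2; congr (_ * _).
by apply: eq_bigr => v _; rewrite e1.
Qed.

Lemma Ex_prod lam (phi : V -> T -> R) :
  Ex lam (fun Z => \prod_v phi v (Z v)) = \prod_v \sum_k lam v k * phi v k.
Proof.
by rewrite bigA_distr_bigA /=; apply: eq_bigr => Z _; rewrite -big_split.
Qed.

Lemma Ex1 lam : (forall v, is_law (lam v)) -> Ex lam (fun=> 1) = 1.
Proof.
move=> Hl; have := Ex_prod lam (fun _ _ => 1).
rewrite (_ : (fun _ => \prod_v 1) = fun=> 1); last first.
  by apply/funext => Z; rewrite big1.
move=> ->; rewrite big1 // => v _; under eq_bigr do rewrite mulr1.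
by case: (Hl v).
Qed.

Lemma ExD lam g g' : Ex lam (fun Z => g Z + g' Z) = Ex lam g + Ex lam g'.
Proof. by rewrite -big_split; apply: eq_bigr => Z _; rewrite mulrDr. Qed.

Lemma ExZ lam c g : Ex lam (fun Z => c * g Z) = c * Ex lam g.
Proof. by rewrite mulr_sumr; apply: eq_bigr => Z _; rewrite mulrCA. Qed.

Lemma Ex_sum lam (I : finType) (P : pred I) (G : I -> {ffun V -> T} -> R) :
  Ex lam (fun Z => \sum_(i | P i) G i Z) = \sum_(i | P i) Ex lam (G i).
Proof. by rewrite exchange_big; apply: eq_bigr => Z _; rewrite mulr_sumr. Qed.

Lemma ExB lam g g' : Ex lam (fun Z => g Z - g' Z) = Ex lam g - Ex lam g'.
Proof. by rewrite -sumrB; apply: eq_bigr => Z _; rewrite mulrBr. Qed.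

Lemma Ex_cst lam c : (forall v, is_law (lam v)) -> Ex lam (fun=> c) = c.
Proof.
by move=> Hl; rewrite -[RHS]mulr1 -(Ex1 Hl) -ExZ; apply: eq_Ex => // Z; rewrite mulr1.
Qed.

Lemma weight_ge0 lam Z : (forall v, is_law (lam v)) -> 0 <= \prod_v lam v (Z v).
Proof. by move=> Hl; apply: prodr_ge0 => v _; case: (Hl v). Qed.

Lemma ler_Ex lam g g' : (forall v, is_law (lam v)) ->
  (forall Z, g Z <= g' Z) -> Ex lam g <= Ex lam g'.
Proof.
by move=> Hl gg; apply: ler_sum => Z _; apply: ler_wpM2l; rewrite ?weight_ge0.
Qed.

Lemma norm_Ex lam g : (forall v, is_law (lam v)) ->
  `|Ex lam g| <= Ex lam (fun Z => `|g Z|).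
Proof.
move=> Hl; apply: le_trans (ler_norm_sum _ _ _) _; apply: ler_sum => Z _.
by rewrite normrM ger0_norm ?weight_ge0.
Qed.

Definition upd lam (i : V) p : V -> T -> R := fun v => if v == i then p else lam v.

Lemma upd_law lam i p : (forall v, is_law (lam v)) -> is_law p ->
  forall v, is_law (upd lam i p v).
Proof. by move=> Hl Hp v; rewrite /upd; case: ifP. Qed.

Lemma weight_upd lam i p Z : \prod_v upd lam i p v (Z v) =
  p (Z i) * \prod_(v | v != i) lam v (Z v).
Proof.
rewrite (bigD1 i) //= /upd eqxx; congr (_ * _); apply: eq_bigr => v /negPf ->.
by [].
Qed.

Lemma Ex_upd_linear lam i p g :
  Ex (upd lam i p) g = \sum_k p k * Ex (upd lam i (dirac_law k)) g.
Proof.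
under [RHS]eq_bigr do rewrite mulr_sumr.
rewrite exchange_big /=; apply: eq_bigr => Z _.
rewrite weight_upd -[in LHS](sum_dirac p (Z i)) !mulr_suml; apply: eq_bigr => k _.
by rewrite weight_upd !mulrA.
Qed.

Definition fset_at Z i (b : T) : {ffun V -> T} :=
  [ffun v => if v == i then b else Z v].

(** Freezing a coordinate is the same as overwriting it, whatever law it has:
    this puts two different frozen values on the same probability space. *)
Lemma Ex_upd_dirac lam i p b g : is_law p ->
  Ex (upd lam i (dirac_law b)) g = Ex (upd lam i p) (fun Z => g (fset_at Z i b)).
Proof.
move=> [_ p1]; rewrite /Ex.
rewrite [RHS](partition_big (fun Z => fset_at Z i b) (fun W => W i == b)) /=; last first.
  by move=> Z _; rewrite ffunE eqxx.
rewrite (bigID (fun Z : {ffun V -> T} => Z i == b)) /= addrC big1 ?add0r; last first.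
  by move=> Z /negPf Zb; rewrite weight_upd /dirac_law Zb !mul0r.
apply: eq_bigr => W /eqP Wb.
rewrite weight_upd /dirac_law Wb eqxx mul1r -[LHS]mul1r -[X in X * _ = _]p1 mulr_suml.
rewrite (reindex (fun k => fset_at W i k)) /=; last first.
  exists (fun Z => Z i) => [k _ | Z]; first by rewrite ffunE eqxx.
  rewrite inE => /eqP <-; apply/ffunP => v; rewrite !ffunE.
  by case: (v =P i) => [->|].
apply: eq_big => [k | k _].
  symmetry; apply/eqP/ffunP => v; rewrite !ffunE.
  by case: (v =P i) => [-> |].
rewrite weight_upd ffunE eqxx mulrA; congr (_ * _ * g _).
  by apply: eq_bigr => v vi; rewrite ffunE (negPf vi).
apply/ffunP => v; rewrite !ffunE.
by case: (v =P i) => [->|].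
Qed.

Definition depends_only_on S g :=
  forall Z Z', {in S, forall v, Z v = Z' v} -> g Z = g Z'.

(** The factor 1/2 in the total variation distance is gained by measuring [G]
    from the middle of its range. *)
Lemma sum_diff_le (p p' : T -> R) (G : T -> R) c : is_law p -> is_law p' ->
  (forall a b, `|G a - G b| <= c) ->
  `|\sum_k p k * G k - \sum_k p' k * G k| <= c * tv_dist p p'.
Proof.
move=> [p0 p1] [p'0 p'1] Gc.
have [t0 _] : exists t0 : T, true.
  case: (pickP (xpredT : pred T)) => [x _|no]; first by exists x.
  by move: p1; rewrite big1 => [/esym/eqP|x]; rewrite ?oner_eq0 //; have := no x.
pose lo := [arg min_(k < t0) G k]%O; pose hi := [arg max_(k > t0) G k]%O.
have loP k : G lo <= G k by rewrite /lo; case: arg_minP => // j _ /(_ k); apply.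
have hiP k : G k <= G hi by rewrite /hi; case: arg_maxP => // j _ /(_ k); apply.
pose mid := (G lo + G hi) / 2.
have midP k : `|G k - mid| <= c / 2.
  have := loP k; have := hiP k; have := Gc hi lo.
  rewrite ger0_norm ?subr_ge0 // => h1 h2 h3.
  rewrite ler_norml /mid; apply/andP; split; lra.
have -> : \sum_k p k * G k - \sum_k p' k * G k = \sum_k (p k - p' k) * (G k - mid).
  under [RHS]eq_bigr do rewrite mulrBr.
  rewrite sumrB -mulr_suml sumrB p1 p'1 subrr mul0r subr0 -sumrB.
  by apply: eq_bigr => k _; rewrite mulrBl.
apply: le_trans (ler_norm_sum _ _ _) _.
rewrite /tv_dist mulrA mulr_sumr; apply: ler_sum => k _.
by rewrite normrM mulrC ler_wpM2r.
Qed.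

(** Replacing one factor at a time passes from one product law to another. *)
Lemma Ex_hybrid lam lam' g (delta : V -> R) :
  (forall M i, (forall v, M v = lam v \/ M v = lam' v) ->
    `|Ex (upd M i (lam i)) g - Ex (upd M i (lam' i)) g| <= delta i) ->
  `|Ex lam g - Ex lam' g| <= \sum_i delta i.
Proof.
move=> step.
pose mix (s : seq V) v := if v \in s then lam' v else lam v.
have mixP s v : mix s v = lam v \/ mix s v = lam' v.
  by rewrite /mix; case: ifP => _; [right | left].
have H s : uniq s -> `|Ex lam g - Ex (mix s) g| <= \sum_(i <- s) delta i.
  elim: s => [_|i s IH /= /andP[is_ us]].
    by rewrite big_nil /mix (_ : Ex _ g = Ex lam g) ?subrr ?normr0 //; apply: eq_Ex.
  rewrite big_cons [leRHS]addrC -(subrKA (Ex (mix s) g)); apply: le_trans (ler_normD _ _) _.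
  rewrite lerD ?IH //; apply: le_trans (step (mix s) i (mixP s)).
  rewrite le_eqVlt; apply/orP; left; apply/eqP; congr (`|_ - _|); apply: eq_Ex => // v x.
    by rewrite /upd /mix; case: (v =P i) => // ->; rewrite (negPf is_).
  by rewrite /upd /mix inE; case: (v =P i) => // ->.
have := H (index_enum V) (index_enum_uniq V).
rewrite (_ : Ex (mix _) g = Ex lam' g) //; apply: eq_Ex => // v x.
by rewrite /mix mem_index_enum.
Qed.

(** The laws that recolouring [S] can produce, when every vertex has at least [m]
    available colours. A bound on the point masses is all that the estimates use
    and, unlike uniformity, it is kept when the factors of two such laws are
    mixed. *)
Definition spread (m : R) S lam :=
  forall v, is_law (lam v) /\ (v \in S -> forall k, lam v k <= m^-1).

(** The effect of one colour is measured in the mean over the others, not in the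
    worst case. The supremum over all spread laws is what makes the bound usable
    again after a half-step, whose laws depend on a random colouring. *)
Definition osc_le (m : R) S g (c : R) :=
  forall lam i a b, spread m S lam -> i \in S ->
    `|Ex (upd lam i (dirac_law a)) g - Ex (upd lam i (dirac_law b)) g| <= c.

(** The hybrid laws between two spread laws are spread, so that [osc_le] applies
    to each replacement. *)
Lemma Ex_diff_le m S lam lam' g c : spread m S lam -> spread m S lam' ->
  depends_only_on S g -> osc_le m S g c ->
  `|Ex lam g - Ex lam' g| <= c * \sum_(i in S) tv_dist (lam i) (lam' i).
Proof.
move=> sl sl' gS gc.
rewrite mulr_sumr big_mkcond /=; apply: Ex_hybrid => M i MP.
have sM : spread m S M by move=> v; case: (MP v) => ->; [apply: sl | apply: sl'].
have [li _] := sl i; have [l'i _] := sl' i.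
case: ifP => iS.
  rewrite Ex_upd_linear (Ex_upd_linear M i (lam' i)).
  by apply: sum_diff_le => // a b; apply: gc.
rewrite Ex_upd_linear (Ex_upd_linear M i (lam' i)).
rewrite -[leRHS](mul0r (tv_dist (lam i) (lam' i))).
apply: sum_diff_le => // a b.
rewrite (Ex_upd_dirac _ _ b _ (dirac_lawP a)) -ExB.
rewrite (_ : Ex _ _ = 0) ?normr0 //; apply: big1 => Z _.
rewrite (gS Z (fset_at Z i b)) ?subrr ?mulr0 // => v vS.
by rewrite ffunE; case: eqP => // vi; move: iS; rewrite -vi vS.
Qed.

End ProductLaws.

(** * Unoccupied colours *)

Section RealBounds.
Variable R : realType.

Lemma expR_ge_quadratic (x : R) : 0 <= x -> 1 + x + x ^+ 2 / 2 <= expR x.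
Proof.
move=> x0.
have -> : 1 + x + x ^+ 2 / 2 = series (exp_coeff x) 3.
  rewrite /series /= !big_nat_recr //= big_geq // add0r /exp_coeff /=.
  by rewrite expr0 expr1 !fact0 ?factS !fact0 !divr1.
apply: nondecreasing_cvgn_le; last exact: is_cvg_series_exp_coeff.
by apply: nondecreasing_series => n _ _; apply: exp_coeff_ge0.
Qed.

(** A slope for which [- ln (1 - p) <= kappa m * p] on [0 <= p <= 1 / m]; it tends
    to 1 as [m] grows. *)
Definition kappa (m : R) := 1 + (2 * (m - 1))^-1.

(** For [x = p + p ^ 2 / (2 (1 - p))] the quadratic lower bound of [exp x] is
    at least [1 / (1 - p)], and [x <= kappa m * p] as soon as [p <= 1 / m]. *)
Lemma expR_kappa_le (m p : R) : 1 < m -> 0 <= p <= m^-1 ->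
  expR (- (kappa m * p)) <= 1 - p.
Proof.
move=> m1 /andP[p0 pm].
have m0 : 0 < m by lra.
have p1 : 0 < 1 - p.
  by rewrite subr_gt0 (le_lt_trans pm) // invf_lt1.
pose x := p + p ^+ 2 / (2 * (1 - p)).
have x0 : 0 <= x by rewrite addr_ge0 // divr_ge0 ?sqr_ge0 // ltW // mulr_gt0.
have xk : x <= kappa m * p.
  rewrite /x /kappa [leRHS]mulrDl mul1r lerD2l expr2 -mulrA [leRHS]mulrC ler_wpM2l //.
  rewrite invfM mulrCA invfM ler_wpM2l // ler_pdivrMr //.
  rewrite mulrC ler_pdivlMr ?subr_gt0 //.
  move: pm; rewrite -(ler_pM2r m0) mulVf ?gt_eqF //.
  by nra.
rewrite expRN invf_ple ?posrE ?expR_gt0 //.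
apply: le_trans (_ : expR x <= _); last by rewrite ler_expR.
apply: le_trans (expR_ge_quadratic x0).
have -> : 1 + x + x ^+ 2 / 2 = (1 - p)^-1 + (p ^+ 2 / (1 - p)) ^+ 2 / 8.
  by rewrite /x; field; rewrite gt_eqF.
by rewrite lerDl divr_ge0 ?sqr_ge0.
Qed.

End RealBounds.

Section Occupancy.
Variables (R : realType) (V T : finType).
Implicit Types (lam : V -> T -> R) (Z : {ffun V -> T}) (M : {set V}).

Lemma Ex_prod_in lam M (phi : V -> T -> R) : (forall v, is_law (lam v)) ->
  Ex lam (fun Z => \prod_(v in M) phi v (Z v)) =
  \prod_(v in M) \sum_k lam v k * phi v k.
Proof.
move=> Hl; rewrite [RHS]big_mkcond /=.
transitivity (Ex lam (fun Z => \prod_v (if v \in M then phi v (Z v) else 1))).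
  by apply: eq_Ex => // Z; rewrite big_mkcond.
rewrite (Ex_prod lam (fun v k => if v \in M then phi v k else 1)).
apply: eq_bigr => v _; case: ifP => // _.
by under eq_bigr do rewrite mulr1; case: (Hl v).
Qed.

(** Expanding [1 / A] to second order around the mean. *)
Lemma Ex_inv_le lam (A : {ffun V -> T} -> R) (m s : R) :
  (forall v, is_law (lam v)) -> 0 < m -> (forall Z, m <= A Z) ->
  Ex lam (fun Z => A Z ^+ 2) <= Ex lam A ^+ 2 + s ->
  Ex lam (fun Z => (A Z)^-1) <= (Ex lam A)^-1 * (1 + s / (Ex lam A * m)).
Proof.
move=> Hl m0 mA; set mu := Ex lam A => Hs.
have mu0 : 0 < mu.
  by apply: lt_le_trans m0 _; rewrite -(Ex_cst m Hl); apply: ler_Ex.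
pose g Z := mu^-1 - (A Z - mu) / mu ^+ 2 + (A Z - mu) ^+ 2 / (mu ^+ 2 * m).
have Ag Z : (A Z)^-1 <= g Z.
  have A0 : 0 < A Z := lt_le_trans m0 (mA Z).
  have -> : (A Z)^-1 = mu^-1 - (A Z - mu) / mu ^+ 2 + (A Z - mu) ^+ 2 / (mu ^+ 2 * A Z).
    by field; rewrite !gt_eqF.
  rewrite lerD2l ler_wpM2l ?sqr_ge0 // lef_pV2 ?posrE ?mulr_gt0 ?exprn_gt0 //.
  by rewrite ler_wpM2l // sqr_ge0.
apply: le_trans (ler_Ex Hl Ag) _.
have -> : Ex lam g = mu^-1 + (Ex lam (fun Z => A Z ^+ 2) - mu ^+ 2) / (mu ^+ 2 * m).
  have -> : Ex lam g = Ex lam (fun Z => (2 / mu + m^-1) +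
      ((- (mu ^+ 2)^-1 - 2 / (mu * m)) * A Z + (mu ^+ 2 * m)^-1 * A Z ^+ 2)).
    by apply: eq_Ex => // Z; rewrite /g; field; rewrite !gt_eqF.
  by rewrite !ExD !ExZ !Ex_cst // -/mu; field; rewrite !gt_eqF.
rewrite mulrDr mulr1 lerD2l.
have -> : mu^-1 * (s / (mu * m)) = s / (mu ^+ 2 * m).
  by field; rewrite !gt_eqF.
by rewrite ler_pM2r ?invr_gt0 ?mulr_gt0 ?exprn_gt0 //; lra.
Qed.

(** The colours available to a vertex that has a neighbour of colour [a], its
    other neighbours forming the set [M]. *)
Definition unused Z M (a : T) : {set T} := ~: (a |: [set Z v | v in M]).

Lemma card_unusedE Z M a : #|unused Z M a|%:R =
  \sum_(k | k != a) \prod_(v in M) (Z v != k)%:R :> R.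
Proof.
rewrite -sum1_card natr_sum big_mkcond [RHS]big_mkcond /=; apply: eq_bigr => k _.
rewrite /unused !inE negb_or; case: (k != a) => //=.
have [/imsetP[v vM ->]|kM] := boolP (k \in [set Z v | v in M]).
  by rewrite (bigD1 v) //= eqxx mul0r.
rewrite big1 // => v vM; rewrite (_ : Z v != k) //.
by apply: contraNneq kM => <-; apply: imset_f.
Qed.

Lemma card_unused_ge Z M a n : (#|M| <= n)%N -> (#|T|.-1 - n <= #|unused Z M a|)%N.
Proof.
move=> Mn; rewrite cardsCs finset.setCK.
have h : (#|a |: [set Z v | v in M]| <= n.+1)%N.
  rewrite cardsU1 (leq_trans (leq_add (leq_b1 _) (leq_imset_card _ _))) //.
by rewrite -subn1 -subnDA add1n leq_sub2l.
Qed.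

Variables (lam : V -> T -> R) (M : {set V}) (a : T).
Hypothesis Hl : forall v, is_law (lam v).

Let P k := \prod_(v in M) (1 - lam v k).

Let lam_ge0 v k : 0 <= lam v k. Proof. by case: (Hl v). Qed.

Let lam_sum v : \sum_k lam v k = 1. Proof. by case: (Hl v). Qed.

Let lam_le1 v k : lam v k <= 1.
Proof. by rewrite -(lam_sum v) (bigD1 k) //= lerDl sumr_ge0. Qed.

Let P_ge0 k : 0 <= P k.
Proof. by apply: prodr_ge0 => v _; rewrite subr_ge0. Qed.

Let avoid v k : \sum_j lam v j * (j != k)%:R = 1 - lam v k.
Proof.
rewrite -[X in _ = X - _](lam_sum v) -[lam v k](sum_dirac (lam v)) -sumrB; apply: eq_bigr => j _.
by rewrite /dirac_law [k == j]eq_sym; case: (j == k); rewrite /= ?mulr1 ?mulr0 ?subrr ?subr0.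
Qed.

Let avoid2 v k l : k != l ->
  \sum_j lam v j * ((j != k)%:R * (j != l)%:R) = 1 - lam v k - lam v l.
Proof.
move=> kl; rewrite -(avoid v k) -[lam v l](sum_dirac (lam v)) -sumrB.
apply: eq_bigr => j _; rewrite -mulrBr /dirac_law [l == j]eq_sym; congr (_ * _).
have [->|_] := eqVneq j l; last by rewrite mulr1 subr0.
by rewrite eq_sym kl mulr0 subrr.
Qed.

Lemma Ex_card_unused : Ex lam (fun Z => #|unused Z M a|%:R) = \sum_(k | k != a) P k.
Proof.
rewrite (eq_Ex (fun _ _ => erefl) (fun Z => card_unusedE Z M a)) Ex_sum.
apply: eq_bigr => k _; rewrite (Ex_prod_in _ (fun _ j => (j != k)%:R)) //.
by apply: eq_bigr => v _; rewrite avoid.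
Qed.

(** Negative correlation: for [k != l] the events that [k] and that [l] is
    unused satisfy [1 - x - y <= (1 - x) (1 - y)] in each factor, so only the
    diagonal terms [P k (1 - P k) <= 1 / 4] add to the variance. *)
Lemma Ex_card_unused_sqr :
  Ex lam (fun Z => #|unused Z M a|%:R ^+ 2) <=
  Ex lam (fun Z => #|unused Z M a|%:R) ^+ 2 + #|T|.-1%:R / 4.
Proof.
rewrite Ex_card_unused.
have -> : Ex lam (fun Z => #|unused Z M a|%:R ^+ 2) =
    \sum_(k | k != a) \sum_(l | l != a)
      \prod_(v in M) \sum_j lam v j * ((j != k)%:R * (j != l)%:R).
  transitivity (Ex lam (fun Z => \sum_(k | k != a) \sum_(l | l != a)
      \prod_(v in M) ((Z v != k)%:R * (Z v != l)%:R))).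
    apply: eq_Ex => // Z; rewrite card_unusedE expr2 mulr_suml.
    apply: eq_bigr => k _; rewrite mulr_sumr; apply: eq_bigr => l _.
    by rewrite -big_split.
  rewrite Ex_sum; apply: eq_bigr => k _; rewrite Ex_sum; apply: eq_bigr => l _.
  by rewrite (Ex_prod_in _ (fun _ j => (j != k)%:R * (j != l)%:R)).
have -> : #|T|.-1%:R / 4 = \sum_(k | k != a) (4^-1 : R).
  by rewrite sumr_const cardC1 mulr_natl.
rewrite expr2 mulr_suml -big_split /=; apply: ler_sum => k ka.
rewrite mulr_sumr (bigD1 k) //= [in leRHS](bigD1 k) //= addrAC.
apply: lerD; last first.
  apply: ler_sum => l /andP[_ lk]; rewrite -big_split /=; apply: ler_prod => v _.
  rewrite avoid2 1?eq_sym //; apply/andP; split.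
    rewrite -addrA -opprD subr_ge0 -(lam_sum v) (bigD1 k) //= lerD2l.
    by rewrite (bigD1 l) //= lerDl sumr_ge0.
  by have := mulr_ge0 (lam_ge0 v k) (lam_ge0 v l); lra.
have -> : \prod_(v in M) \sum_j lam v j * ((j != k)%:R * (j != k)%:R) = P k.
  apply: eq_bigr => v _; rewrite -avoid; apply: eq_bigr => j _.
  by case: (j == k); rewrite /= ?mulr0 ?mulr1.
by have := sqr_ge0 (P k - 2^-1); nra.
Qed.

(** Convexity of the exponential, through its tangent at the average exponent. *)
Lemma Ex_card_unused_ge (m : R) (n : nat) : 1 < m -> (#|M| <= n)%N ->
  (1 < #|T|)%N ->
  (forall v, v \in M -> forall k, lam v k <= m^-1) ->
  #|T|.-1%:R * expR (- (kappa m * (n%:R / #|T|.-1%:R))) <=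
  Ex lam (fun Z => #|unused Z M a|%:R).
Proof.
move=> m1 Mn T1 lm; rewrite Ex_card_unused; set N : R := #|T|.-1%:R.
have N0 : 0 < N by rewrite ltr0n -ltnS prednK // (leq_trans _ T1).
have km0 : 0 <= kappa m.
  by rewrite addr_ge0 // invr_ge0 mulr_ge0 // subr_ge0 ltW.
pose s k := \sum_(v in M) lam v k.
pose x0 := - (kappa m * (n%:R / N)).
have Ps k : expR x0 * (1 - kappa m * s k - x0) <= P k.
  apply: le_trans (_ : expR (- (kappa m * s k)) <= _).
    rewrite -[in leRHS](addrNK x0 (- (kappa m * s k))) [leRHS]expRD mulrC.
    rewrite ler_wpM2r ?expR_ge0 //.
    by apply: le_trans (expR_ge1Dx _); rewrite addrA.
  rewrite /s mulr_sumr -sumrN expR_sum; apply: ler_prod => v vM.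
  by rewrite expR_ge0 /=; apply: expR_kappa_le; rewrite ?lam_ge0 ?lm.
apply: le_trans (ler_sum _ (fun k _ => Ps k)).
rewrite -mulr_sumr mulrC ler_wpM2l ?expR_ge0 //.
have -> : \sum_(k | k != a) (1 - kappa m * s k - x0) =
    N * (1 - x0) - kappa m * \sum_(k | k != a) s k.
  rewrite mulr_sumr.
  have -> : N * (1 - x0) = \sum_(k | k != a) (1 - x0).
    by rewrite sumr_const cardC1 mulr_natl.
  by rewrite -sumrB; apply: eq_bigr => k _; rewrite addrAC.
have sn : \sum_(k | k != a) s k <= n%:R.
  apply: le_trans (_ : \sum_k s k <= _).
    by rewrite [leRHS](bigD1 a) //= lerDr sumr_ge0.
  rewrite exchange_big /=; under eq_bigr do rewrite lam_sum.
  by rewrite sumr_const ler_nat.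
have : N * x0 = - (kappa m * n%:R) by rewrite /x0; field; rewrite gt_eqF.
by have := ler_wpM2l km0 sn; lra.
Qed.

(** The first term holds without randomness, as at least [N - n] colours are
    unused; the second one is the estimate at the mean, with the factor
    [1 + N / (4 * m ^+ 2)] paying for the variance. *)
Definition inv_unused_bound (n N : nat) : R :=
  let m := (N - n)%:R in
  Num.min m^-1
    ((1 + N%:R / (4 * m ^+ 2)) * (N%:R^-1 * expR (kappa m * (n%:R / N%:R)))).

Lemma inv_unused_bound_ge0 n N : 0 <= inv_unused_bound n N.
Proof. by rewrite le_min invr_ge0 ler0n /= mulr_ge0 ?mulr_ge0 ?invr_ge0 ?expR_ge0. Qed.

Lemma inv_unused_bound_gt0 n N : (n < N)%N -> 0 < inv_unused_bound n N.
Proof.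
move=> nN; have N0 : 0 < N%:R :> R by rewrite ltr0n (leq_ltn_trans _ nN).
rewrite lt_min invr_gt0 ltr0n subn_gt0 nN mulr_gt0 ?ltr_wpDr ?divr_ge0 //.
by rewrite mulr_gt0 ?invr_gt0 ?expR_gt0.
Qed.

Lemma Ex_inv_unused (n : nat) : (#|M| <= n)%N -> (n.+1 < #|T|.-1)%N ->
  (forall v, v \in M -> forall k, lam v k <= (#|T|.-1 - n)%:R^-1) ->
  Ex lam (fun Z => #|unused Z M a|%:R^-1) <= inv_unused_bound n #|T|.-1.
Proof.
move=> Mn nT lm; rewrite /inv_unused_bound; set N := #|T|.-1.
have m1 : 1 < (N - n)%:R :> R by rewrite ltr1n ltn_subRL addn1.
set m : R := (N - n)%:R in m1 *.
have m0 : 0 < m by lra.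
have mA Z : m <= #|unused Z M a|%:R by rewrite ler_nat card_unused_ge.
rewrite le_min; apply/andP; split.
  rewrite -[leRHS](Ex_cst _ Hl); apply: ler_Ex => // Z.
  by rewrite lef_pV2 ?posrE // (lt_le_trans m0).
have N0 : 0 < N%:R :> R by rewrite ltr0n (leq_trans _ nT).
apply: le_trans (Ex_inv_le Hl m0 mA Ex_card_unused_sqr) _.
have := @Ex_card_unused_ge m n m1 Mn _ lm; set mu := Ex lam _.
rewrite -/N => /(_ _) mu_ge.
have {}mu_ge : N%:R * expR (- (kappa m * (n%:R / N%:R))) <= mu.
  by apply: mu_ge; rewrite (leq_trans _ (leq_trans nT (leq_pred _))).
have mmu : m <= mu by rewrite -(Ex_cst m Hl); apply: ler_Ex.
have mu0 : 0 < mu by lra.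
rewrite [leRHS]mulrC; apply: ler_pM.
- by rewrite invr_ge0 ltW.
- by rewrite addr_ge0 // divr_ge0 ?divr_ge0 ?mulr_ge0 // ltW.
- rewrite -[expR _]invrK -expRN -invfM lef_pV2 ?posrE ?mulr_gt0 ?expR_gt0 //.
rewrite lerD2l -mulrA -invfM ler_wpM2l ?(ltW N0) //.
rewrite lef_pV2 ?posrE ?mulr_gt0 ?exprn_gt0 // ler_wpM2l // expr2.
by rewrite ler_wpM2r // ltW.
Qed.

End Occupancy.

(** * Kernels acting on functions *)

Section KernelAction.
Variables (R : realType) (T : finType).
Implicit Types (K L : T -> T -> R) (h pi : T -> R).

Definition act K h x := \sum_y K x y * h y.

Lemma act_comp K L h x : act (comp_kernel K L) h x = act K (act L h) x.
Proof.
rewrite /act /comp_kernel; under eq_bigr do rewrite mulr_suml.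
rewrite exchange_big /=; apply: eq_bigr => y _; rewrite mulr_sumr.
by apply: eq_bigr => z _; rewrite mulrA.
Qed.

Definition invariant_law pi K := forall y, \sum_x pi x * K x y = pi y.

Lemma invariant_law_comp pi K L :
  invariant_law pi K -> invariant_law pi L -> invariant_law pi (comp_kernel K L).
Proof.
move=> iK iL z; rewrite /comp_kernel; under eq_bigr do rewrite mulr_sumr.
rewrite exchange_big /= -[RHS]iL; apply: eq_bigr => y _.
by rewrite -(iK y) mulr_suml; apply: eq_bigr => x _; rewrite mulrA.
Qed.

Lemma invariant_law_iter pi K t : invariant_law pi K -> invariant_law pi (iter_kernel K t).
Proof.
move=> iK; elim: t => [y|t IH]; last exact: invariant_law_comp.
rewrite (bigD1 y) //= eqxx mulr1 big1 ?addr0 // => x /negPf ->.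
by rewrite mulr0.
Qed.

(** The sign of the difference of two laws is a test function that attains their
    total variation distance. *)
Lemma tv_dist_invariant_le pi K B x : is_law pi -> invariant_law pi K ->
  (forall h, (forall y, `|h y| <= 1) -> forall y z, `|act K h y - act K h z| <= 2 * B) ->
  tv_dist (K x) pi <= B.
Proof.
move=> [pi0 pi1] iK KB; pose h y := Num.sg (K x y - pi y).
have h1 y : `|h y| <= 1 by rewrite /h normr_sg; case: (_ != 0).
have E : \sum_y `|K x y - pi y| = \sum_z pi z * (act K h x - act K h z).
  under [RHS]eq_bigr do rewrite mulrBr.
  rewrite sumrB -mulr_suml pi1 mul1r.
  have -> : \sum_z pi z * act K h z = \sum_y pi y * h y.
    under eq_bigr do rewrite mulr_sumr; rewrite exchange_big /=.
    apply: eq_bigr => y _; rewrite -(iK y) mulr_suml.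
    by apply: eq_bigr => z _; rewrite mulrA.
  rewrite -sumrB; apply: eq_bigr => y _.
  by rewrite -mulrBl /h mulrC -normrEsg.
rewrite /tv_dist E -[leRHS](mulKf (_ : 2 != 0 :> R)) ?pnatr_eq0 // ler_wpM2l //.
rewrite -[leRHS]mul1r -[X in _ <= X * _]pi1 mulr_suml; apply: ler_sum => z _.
by rewrite ler_wpM2l //; apply: le_trans (ler_norm _) _; apply: KB.
Qed.

End KernelAction.

(** * Total variation distance *)

Section TotalVariation.
Variables (R : realType) (T : finType).
Implicit Types (p : T -> R) (A B W : {set T}).

Lemma tv_distC p p' : tv_dist p p' = tv_dist p' p.
Proof. by congr (_ * _); apply: eq_bigr => k _; rewrite distrC. Qed.

Lemma tv_dist_self p : tv_dist p p = 0.
Proof. by rewrite /tv_dist big1 ?mulr0 // => k _; rewrite subrr normr0. Qed.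

(** [|x - y| = 2 (x - y)^+ - (x - y)], and the second part sums to zero. *)
Lemma tv_dist_le_excess p p' W : is_law p -> is_law p' ->
  (forall k, k \notin W -> p k <= p' k) -> tv_dist p p' <= \sum_(k in W) p k.
Proof.
move=> [p0 p1] [p'0 p'1] pW.
have : \sum_k `|p k - p' k| <= \sum_k ((if k \in W then 2 * p k else 0) - p k + p' k).
  apply: ler_sum => k _; rewrite ler_norml.
  have := p0 k; have := p'0 k; case: ifPn => [_|/pW]; move=> h1 h2.
    by apply/andP; split; lra.
  by move=> h3; apply/andP; split; lra.
rewrite big_split sumrB /= p1 p'1 subrK -big_mkcond -mulr_sumr /tv_dist; lra.
Qed.

Lemma tv_dist_le1 p p' : is_law p -> is_law p' -> tv_dist p p' <= 1.
Proof.
move=> lp lp'; apply: le_trans (tv_dist_le_excess (W := [set: T]) lp lp' _) _.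
  by move=> k; rewrite inE.
by rewrite (eq_bigl predT) => [|k]; [case: lp => _ -> | rewrite inE].
Qed.

Definition uniform_on A : T -> R := fun k => if k \in A then #|A|%:R^-1 else 0.

Lemma uniform_on_law A : (0 < #|A|)%N -> is_law (uniform_on A).
Proof.
move=> A0; split=> [k|]; first by rewrite /uniform_on; case: ifP.
rewrite /uniform_on -big_mkcond sumr_const -[LHS]mulr_natr mulVf //.
by rewrite pnatr_eq0 -lt0n.
Qed.

Lemma uniform_on_le A k : uniform_on A k <= #|A|%:R^-1.
Proof. by rewrite /uniform_on; case: ifP. Qed.

(** The larger of the two sets has the smaller point masses, and exceeds the other
    set by at most one point. *)
Lemma tv_uniform_on A B a b : (0 < #|A|)%N -> (0 < #|B|)%N ->
  A \subset b |: B -> B \subset a |: A ->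
  tv_dist (uniform_on A) (uniform_on B) <= #|A|%:R^-1.
Proof.
have key A' B' c : (0 < #|A'|)%N -> (0 < #|B'|)%N -> A' \subset c |: B' ->
    (#|B'| <= #|A'|)%N -> tv_dist (uniform_on A') (uniform_on B') <= #|A'|%:R^-1.
  move=> A0 B0 AB BA.
  apply: le_trans (tv_dist_le_excess (W := [set c]) _ _ _) _;
    rewrite ?big_set1 ?uniform_on_le //; try exact: uniform_on_law.
  move=> k; rewrite inE => kc; rewrite /uniform_on; case: ifP => kA; last by case: ifP.
  have := fintype.subsetP AB _ kA; rewrite !inE (negPf kc) /= => ->.
  by rewrite lef_pV2 ?posrE ?ltr0n // ler_nat.
move=> A0 B0 AB BA; have [BlA|AlB] := leqP #|B| #|A|; first exact: (key _ _ b).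
rewrite tv_distC; apply: le_trans (key _ _ a B0 A0 BA (ltnW AlB)) _.
by rewrite lef_pV2 ?posrE ?ltr0n // ler_nat ltnW.
Qed.

End TotalVariation.

(** * Contraction of one half-step *)

Section Bipartition.
Variables (V : finType) (e : rel V) (S S' : {set V}).
Hypothesis bip : is_bipartition e S S'.

Lemma bipartition_sym : is_bipartition e S' S.
Proof.
case: bip => SS' dis ed; split; first by rewrite finset.setUC.
  by rewrite disjoint_sym.
by move=> u v /ed; rewrite orbC.
Qed.

Lemma bipartition_notin v : (v \in S') = (v \notin S).
Proof.
case: bip => SS' dis _; have [vS|vS] := boolP (v \in S).
  exact: (disjointFr dis).
by have := finset.in_setT v; rewrite -SS' inE (negPf vS).
Qed.

Lemma bipartition_edge u v : e u v -> (v \in S') = (u \in S).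
Proof.
case: bip => SS' dis ed; move=> /ed /orP[] /andP[uS vS]; first by rewrite uS vS.
by rewrite (disjointFl dis uS) (disjointFr dis vS).
Qed.

End Bipartition.

Section HalfStep.
Variables (R : realType) (V : finType) (e : rel V) (q D : nat).
Hypothesis D0 : (0 < D)%N.
Hypothesis Dq : (D.+1 < q)%N.
Hypothesis esym : symmetric e.
Hypothesis deg : forall v, (#|neighbours e v| <= D)%N.

Local Notation col := {ffun V -> 'I_q}.
Implicit Types (X Y Z : col) (h g : col -> R) (S : {set V}).

Local Notation m := ((q.-1 - D.-1)%:R : R).

Lemma recolour_vertexE X v : recolour_vertex R e X v = uniform_on R (~: nbr_colours e X v).
Proof. by apply/funext => c; rewrite /uniform_on inE. Qed.

Lemma card_nbr_colours X v : (q.-1 - D.-1 <= #|~: nbr_colours e X v|)%N.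
Proof.
rewrite cardsCs finset.setCK card_ord -subn1 -[D.-1]subn1 subnBA // subnK; last first.
  by rewrite (leq_trans _ Dq).
by apply: leq_sub2l; apply: leq_trans (leq_imset_card _ _) (deg v).
Qed.

Lemma few_enough : (1 < q.-1 - D.-1)%N.
Proof. by case: q Dq D0 => // q'; case: D => // D'; rewrite ltn_subRL addn1. Qed.

Lemma card_nbr_colours_gt0 X v : (0 < #|~: nbr_colours e X v|)%N.
Proof. by rewrite (leq_trans _ (card_nbr_colours X v)) // ltnW // few_enough. Qed.

Lemma recolour_vertex_law X v : is_law (recolour_vertex R e X v).
Proof. by rewrite recolour_vertexE; apply/uniform_on_law/card_nbr_colours_gt0. Qed.

Definition recolour_laws S X v : 'I_q -> R :=
  if v \in S then recolour_vertex R e X v else dirac_law R (X v).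

Lemma recolour_setE S X Y :
  recolour_set R e S X Y = \prod_v recolour_laws S X v (Y v).
Proof.
rewrite [RHS](bigID (mem S)) /=; congr (_ * _).
  by apply: eq_bigr => v vS; rewrite /recolour_laws vS.
apply: eq_big => v; first by rewrite inE.
by rewrite inE /recolour_laws => /negPf ->.
Qed.

Lemma recolour_laws_spread S X : spread m S (recolour_laws S X).
Proof.
rewrite /recolour_laws => v; split.
  by case: ifP => _; [apply: recolour_vertex_law | apply: dirac_lawP].
move=> -> k; rewrite recolour_vertexE; apply: le_trans (uniform_on_le _ _ _) _.
rewrite lef_pV2 ?posrE ?ltr0n ?ler_nat ?card_nbr_colours ?card_nbr_colours_gt0 //.
exact: ltnW few_enough.
Qed.

Lemma recolour_laws_law S X v : is_law (recolour_laws S X v).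
Proof. by case: (recolour_laws_spread S X v). Qed.

Definition recolour S h X : R := Ex (recolour_laws S X) h.

Lemma nbr_colours_fset_at Z i a u : e u i ->
  ~: nbr_colours e (fset_at Z i a) u = unused Z (neighbours e u :\ i) a.
Proof.
move=> ui; congr (~: _); have iu : i \in neighbours e u by rewrite inE.
rewrite /nbr_colours -{1}(finset.setD1K iu).
rewrite imsetU1 ffunE eqxx; congr (_ |: _); apply: eq_in_imset => v.
by rewrite !inE ffunE => /andP[/negPf ->].
Qed.

Lemma nbr_colours_eq X Y u : {in neighbours e u, forall v, X v = Y v} ->
  nbr_colours e X u = nbr_colours e Y u.
Proof. by move=> XY; apply: eq_in_imset. Qed.

(** With [A], [B] the colours available at [u] when its neighbour [i] has colour
    [a], [b], the set [A] misses at most [a] and the set [B] at most [b] of the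
    colours left by the other neighbours. *)
Lemma tv_recolour_vertex Z i a b u :
  tv_dist (recolour_vertex R e (fset_at Z i a) u)
          (recolour_vertex R e (fset_at Z i b) u) <=
  if e u i then #|unused Z (neighbours e u :\ i) a|%:R^-1 else 0.
Proof.
case: ifPn => ui; last first.
  rewrite !recolour_vertexE (@nbr_colours_eq _ (fset_at Z i b)) ?tv_dist_self // => v.
  rewrite !inE !ffunE => uv; case: eqP => // vi; move: ui; by rewrite -vi uv.
rewrite !recolour_vertexE.
have A0 := card_nbr_colours_gt0 (fset_at Z i a) u.
have B0 := card_nbr_colours_gt0 (fset_at Z i b) u.
rewrite !nbr_colours_fset_at // in A0 B0 *.
apply: (@tv_uniform_on _ _ _ _ a b) => //; apply/fintype.subsetP => k;
  rewrite !inE !negb_or; by case: (k == a); case: (k == b).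
Qed.

Local Notation rate := (D%:R * inv_unused_bound R D.-1 q.-1).

(** Only the at most [D] neighbours of [i] feel a change at [i]; each of them
    does with probability [1 / A], and the mean of [1 / A] over the other colours
    of its neighbourhood is at most [inv_unused_bound]. *)
Lemma recolour_contracts S S' g c : is_bipartition e S S' ->
  0 <= c -> depends_only_on S' g -> osc_le m S' g c ->
  osc_le m S (recolour S' g) (rate * c).
Proof.
move=> bip c0 gS' gc lam i a b sl iS.
have Hl v : is_law (lam v) by case: (sl v).
set L := upd lam i (dirac_law R a).
have HL v : is_law (L v) by apply: upd_law => //; apply: dirac_lawP.
rewrite (Ex_upd_dirac lam i a _ (dirac_lawP R a)) -/L.
rewrite (Ex_upd_dirac lam i b _ (dirac_lawP R a)) -/L -ExB.
apply: le_trans (norm_Ex _ HL) _.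
pose G Z := \sum_(u in S' | e u i) c * #|unused Z (neighbours e u :\ i) a|%:R^-1.
apply: le_trans (_ : Ex L G <= _).
  apply: ler_Ex => // Z.
  apply: le_trans (Ex_diff_le (recolour_laws_spread _ _) (recolour_laws_spread _ _) gS' gc) _.
  rewrite mulr_sumr /G big_mkcondr /=; apply: ler_sum => u uS'.
  rewrite /recolour_laws uS' -[X in if _ then _ else X](mulr0 c) -fun_if.
  by rewrite ler_wpM2l // tv_recolour_vertex.
rewrite /G Ex_sum.
apply: le_trans (_ : \sum_(u in S' | e u i) c * inv_unused_bound R D.-1 q.-1 <= _).
  apply: ler_sum => u /andP[uS' ui]; rewrite ExZ ler_wpM2l //.
  have := @Ex_inv_unused R V 'I_q L (neighbours e u :\ i) a HL D.-1.
  rewrite card_ord; apply.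
  - have := deg u; rewrite (cardsD1 i) inE ui add1n => h.
    by rewrite -ltnS (leq_trans h) // leqSpred.
  - by rewrite prednK // -ltnS prednK // (leq_trans _ Dq).
  move=> v; rewrite !inE => /andP[vi uv] k; rewrite /L /upd (negPf vi).
  case: (sl v) => _; apply.
  by rewrite (bipartition_edge (bipartition_sym bip) uv).
rewrite sumr_const -[leLHS]mulr_natl [c * _]mulrC mulrA ler_wpM2r // ler_wpM2r //.
  exact: inv_unused_bound_ge0.
rewrite ler_nat; apply: leq_trans (deg i); apply: subset_leq_card.
by apply/fintype.subsetP => u; rewrite !inE esym => /andP[].
Qed.

Lemma recolour_depends S S' h : is_bipartition e S S' ->
  depends_only_on S' (recolour S h).
Proof.
move=> bip X Y XY; apply: eq_Ex => // v k; rewrite /recolour_laws.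
case: ifPn => vS; last by rewrite XY // (bipartition_notin bip).
rewrite !recolour_vertexE (@nbr_colours_eq X Y) // => w; rewrite inE => vw.
by apply: XY; rewrite (bipartition_edge bip vw).
Qed.

Lemma recolour_fixed S S' h : is_bipartition e S S' -> depends_only_on S' h ->
  recolour S h =1 h.
Proof.
move=> bip hS' X; rewrite -[RHS](Ex_cst (h X) (recolour_laws_law S X)).
apply: eq_bigr => Z _.
have [XZ|] := boolP [forall v in S', Z v == X v].
  by congr (_ * _); apply: hS' => v vS'; apply/eqP; exact: (forall_inP XZ).
rewrite negb_forall => /existsP[v]; rewrite negb_imply => /andP[vS' vX].
have vS : v \notin S by rewrite -(bipartition_notin bip).
by rewrite (bigD1 v) //= /recolour_laws (negPf vS) /dirac_law (negPf vX) !mul0r.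
Qed.

Lemma recolour_ext S h h' : h =1 h' -> recolour S h =1 recolour S h'.
Proof. by move=> hh X; apply: eq_Ex. Qed.

Lemma eq_osc_le S h h' c : h =1 h' -> osc_le m S h c -> osc_le m S h' c.
Proof.
move=> hh H lam i a b sl iS; rewrite -(eq_Ex (fun _ _ => erefl) hh).
by rewrite -(eq_Ex (fun _ _ => erefl) hh); apply: H.
Qed.

Lemma osc_le_weaken S h c c' : c <= c' -> osc_le m S h c -> osc_le m S h c'.
Proof. by move=> cc H lam i a b sl iS; apply: le_trans cc; apply: H. Qed.

Lemma osc_le_bounded S h : (forall X, `|h X| <= 1) -> osc_le m S h 2.
Proof.
move=> h1 lam i a b sl _.
have Hl k v : is_law (upd lam i (dirac_law R k) v).
  by apply: upd_law => [w|]; [case: (sl w) | apply: dirac_lawP].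
have E1 k : `|Ex (upd lam i (dirac_law R k)) h| <= 1.
  apply: le_trans (norm_Ex _ (Hl k)) _; rewrite -[leRHS](Ex_cst 1 (Hl k)).
  exact: ler_Ex.
by apply: le_trans (ler_normB _ _) _; apply: lerD.
Qed.

Lemma recolour_bounded S h : (forall X, `|h X| <= 1) -> forall X, `|recolour S h X| <= 1.
Proof.
move=> h1 X; have Hl := recolour_laws_law S X.
apply: le_trans (norm_Ex _ Hl) _; rewrite -[leRHS](Ex_cst 1 Hl); exact: ler_Ex.
Qed.

Lemma osc_le_mean S f g c : osc_le m S f c -> osc_le m S g c ->
  osc_le m S (fun X => 2^-1 * f X + 2^-1 * g X) c.
Proof.
move=> Hf Hg lam i a b sl iS; rewrite !ExD !ExZ.
have := Hf _ _ a b sl iS; have := Hg _ _ a b sl iS.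
rewrite !ler_norml => /andP[h1 h2] /andP[h3 h4]; apply/andP; split; lra.
Qed.

(** The quantity that contracts: how much [h] can depend on one colour of the
    side that has just been recoloured, the other side being about to be. *)
Definition sensitivity_le S S' h c :=
  osc_le m S (recolour S' h) c /\ osc_le m S' (recolour S h) c.

Definition round S S' h := recolour S (recolour S' h).

Hypothesis rate1 : rate <= 1.

Let rate0 : 0 <= rate. Proof. by rewrite mulr_ge0 // inv_unused_bound_ge0. Qed.

Lemma sensitivity_le_sym S S' h c :
  sensitivity_le S S' h c -> sensitivity_le S' S h c.
Proof. by case. Qed.

(** A round changes sides at least once, even when it starts with the side that
    the preceding round recoloured last, since recolouring twice the same side
    amounts to recolouring it once. *)
Lemma sensitivity_le_round S S' h c : is_bipartition e S S' -> 0 <= c ->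
  sensitivity_le S S' h c -> sensitivity_le S S' (round S S' h) (rate * c).
Proof.
move=> bip c0 [Hh _].
have bip' := bipartition_sym bip.
have H1 : osc_le m S' (round S S' h) (rate * c).
  by apply: recolour_contracts => //; apply: recolour_depends.
split; last first.
  apply: eq_osc_le H1 => X; symmetry; apply: (recolour_fixed bip).
  exact: recolour_depends.
apply: osc_le_weaken (_ : osc_le m S _ (rate * (rate * c))).
  by rewrite -[leRHS]mul1r ler_wpM2r // mulr_ge0.
by apply: recolour_contracts => //; [rewrite mulr_ge0 | apply: recolour_depends].
Qed.

Lemma round_diff_le S S' h c X Y : is_bipartition e S S' -> 0 <= c ->
  sensitivity_le S S' h c -> `|round S S' h X - round S S' h Y| <= #|V|%:R * c.
Proof.
move=> bip c0 [Hh _].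
apply: le_trans (Ex_diff_le (recolour_laws_spread _ _) (recolour_laws_spread _ _)
  (recolour_depends _ (bipartition_sym bip)) Hh) _.
rewrite mulrC ler_wpM2r //.
apply: le_trans (_ : \sum_(i in S) 1 <= _); last first.
  by rewrite sumr_const ler_nat max_card.
by apply: ler_sum => i _; apply: tv_dist_le1; apply: recolour_laws_law.
Qed.

(** * Stationarity *)

Lemma proper_colouringP X : reflect (forall u v, e u v -> X u != X v) (proper_colouring e X).
Proof.
apply: (iffP forallP) => [H u v uv|H u]; first by move: (H u) => /forallP/(_ v); rewrite uv.
by apply/forallP => v; apply/implyP; apply: H.
Qed.

Lemma recolour_set_off S S' X Y : is_bipartition e S S' -> recolour_set R e S X Y != 0 ->
  {in S', forall v, Y v = X v}.
Proof.
move=> bip; rewrite recolour_setE => /prodf_neq0 H v vS'.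
have vS : v \notin S by rewrite -(bipartition_notin bip).
have := H v isT; rewrite /recolour_laws (negPf vS).
by rewrite /dirac_law; case: (Y v =P X v) => // _; rewrite eqxx.
Qed.

Lemma recolour_set_proper S S' X Y : is_bipartition e S S' ->
  recolour_set R e S X Y != 0 -> proper_colouring e Y.
Proof.
move=> bip XY; have off := recolour_set_off bip XY.
have main u v : u \in S -> e u v -> Y u != Y v.
  move=> uS uv; move: XY; rewrite recolour_setE => /prodf_neq0 /(_ u isT).
  rewrite /recolour_laws uS /recolour_vertex; case: ifP; last by rewrite eqxx.
  move=> Yu _; apply: contraNneq Yu => ->; rewrite off ?imset_f ?inE //.
  by rewrite (bipartition_edge bip uv).
apply/proper_colouringP => u v uv; have [uS|uS] := boolP (u \in S); first exact: main.
rewrite eq_sym; apply: main; last by rewrite esym.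
by rewrite (bipartition_edge (bipartition_sym bip) uv) (bipartition_notin bip).
Qed.

(** Detailed balance: both directions choose among the same colours, which are
    determined by the side that is not recoloured. *)
Lemma recolour_set_reversible S S' X Y : is_bipartition e S S' ->
  proper_colouring e X -> recolour_set R e S X Y != 0 ->
  recolour_set R e S Y X = recolour_set R e S X Y.
Proof.
move=> bip pX XY; have off := recolour_set_off bip XY.
have pY := recolour_set_proper bip XY.
rewrite !recolour_setE; apply: eq_bigr => v _; rewrite /recolour_laws.
case: ifPn => vS; last by rewrite /dirac_law eq_sym.
have nE : nbr_colours e Y v = nbr_colours e X v.
  by apply: nbr_colours_eq => w; rewrite inE => vw; apply: off; rewrite (bipartition_edge bip vw).
have avail Z : proper_colouring e Z -> Z v \notin nbr_colours e Z v.
  move=> /proper_colouringP pZ; apply/imsetP => -[w]; rewrite inE => /pZ /eqP.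
  by [].
have := avail Y pY; rewrite nE => YX.
by rewrite /recolour_vertex nE YX avail.
Qed.

Lemma recolour_set_sum1 S X : \sum_Y recolour_set R e S X Y = 1.
Proof.
rewrite -(Ex1 (recolour_laws_law S X)); apply: eq_bigr => Y _.
by rewrite recolour_setE mulr1.
Qed.

Lemma recolour_set_stationary S S' : is_bipartition e S S' ->
  invariant_law (uniform_proper R e q) (recolour_set R e S).
Proof.
move=> bip Y; set pi := uniform_proper R e q.
rewrite -[RHS]mulr1 -(recolour_set_sum1 S Y) mulr_sumr; apply: eq_bigr => X _.
have half X1 Y1 : proper_colouring e X1 -> recolour_set R e S X1 Y1 != 0 ->
    pi X1 * recolour_set R e S X1 Y1 = pi Y1 * recolour_set R e S Y1 X1.
  move=> pX XY; rewrite (recolour_set_reversible bip pX XY); congr (_ * _).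
  by rewrite /pi /uniform_proper pX (recolour_set_proper bip XY).
have zero X1 : ~~ proper_colouring e X1 -> pi X1 = 0.
  by rewrite /pi /uniform_proper => /negPf ->.
have [pX|pX] := boolP (proper_colouring e X); last first.
  have [->|YX] := eqVneq (recolour_set R e S Y X) 0; first by rewrite zero // mul0r mulr0.
  by move: pX; rewrite (recolour_set_proper bip YX).
have [XY|XY] := eqVneq (recolour_set R e S X Y) 0; last exact: half.
have [pY|pY] := boolP (proper_colouring e Y); last by rewrite (zero Y) // XY mulr0 mul0r.
have [->|YX] := eqVneq (recolour_set R e S Y X) 0; first by rewrite XY !mulr0.
by symmetry; apply: half.
Qed.

(** * The two chains *)

Variables S S' : {set V}.
Hypothesis bip : is_bipartition e S S'.

Local Notation pi := (uniform_proper R e q : col -> R).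

Let bip' := bipartition_sym bip.

Lemma act_recolour_set U (h : col -> R) X : act (recolour_set R e U) h X = recolour U h X.
Proof. by apply: eq_bigr => Y _; rewrite recolour_setE. Qed.

Lemma act_scan U U' (h : col -> R) : act (scan R e q U U') h =1 round U U' h.
Proof.
move=> X; rewrite /scan act_comp act_recolour_set; apply: recolour_ext => Y.
exact: act_recolour_set.
Qed.

Lemma act_multicolour (h : col -> R) X : act (multicolour R e q S S') h X =
  2^-1 * round S S' h X + 2^-1 * round S' S h X.
Proof.
rewrite -!act_scan /act !mulr_sumr -big_split; apply: eq_bigr => Y _.
by rewrite mulrDl !mulrA.
Qed.

Lemma recolour_mean U (f g : col -> R) X :
  recolour U (fun Y => 2^-1 * f Y + 2^-1 * g Y) X =
  2^-1 * recolour U f X + 2^-1 * recolour U g X.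
Proof. by rewrite /recolour ExD !ExZ. Qed.

Local Notation sens := (sensitivity_le S S').

Lemma eq_sensitivity_le (f g : col -> R) c : f =1 g -> sens f c -> sens g c.
Proof.
by move=> fg [h1 h2]; split;
  [apply: eq_osc_le h1 | apply: eq_osc_le h2]; apply: recolour_ext.
Qed.

Lemma sensitivity_le_mean (f g : col -> R) c :
  sens f c -> sens g c -> sens (fun X => 2^-1 * f X + 2^-1 * g X) c.
Proof.
move=> [f1 f2] [g1 g2]; split.
  by apply: eq_osc_le (osc_le_mean f1 g1) => X; rewrite recolour_mean.
by apply: eq_osc_le (osc_le_mean f2 g2) => X; rewrite recolour_mean.
Qed.

(** The common ground of SCAN and MULTICOLOUR: all that the mixing bound needs. *)
Record contracting (K : col -> col -> R) : Prop := Contracting {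
  contracting_inv : invariant_law pi K;
  contracting_sens : forall h c, 0 <= c -> sens h c -> sens (act K h) (rate * c);
  contracting_diff : forall h c X Y, 0 <= c -> sens h c ->
    `|act K h X - act K h Y| <= #|V|%:R * c }.

Lemma scan_contracting : contracting (scan R e q S S').
Proof.
split.
- apply: invariant_law_comp; first exact: (recolour_set_stationary bip).
  exact: (recolour_set_stationary bip').
- move=> h c c0 /(sensitivity_le_round bip c0).
  by apply: eq_sensitivity_le => X; rewrite act_scan.
- by move=> h c X Y c0 hc; rewrite !act_scan; apply: round_diff_le.
Qed.

Lemma multicolour_contracting : contracting (multicolour R e q S S').
Proof.
have iS := recolour_set_stationary bip.
have iS' := recolour_set_stationary bip'.
split.
- move=> Y; rewrite /multicolour.
  under eq_bigr do rewrite mulrDr mulrCA [pi _ * (_ * comp_kernel (recolour_set _ _ S') _ _ _)]mulrCA.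
  rewrite big_split /= -!mulr_sumr !(invariant_law_comp iS iS') !(invariant_law_comp iS' iS).
  by lra.
- move=> h c c0 hc.
  apply: (@eq_sensitivity_le (fun X => 2^-1 * round S S' h X + 2^-1 * round S' S h X)).
    by move=> X; rewrite act_multicolour.
  apply: sensitivity_le_mean; first exact: sensitivity_le_round.
  apply: sensitivity_le_sym; apply: sensitivity_le_round => //.
  exact: sensitivity_le_sym.
- move=> h c X Y c0 hc; rewrite !act_multicolour.
  have h1 := round_diff_le X Y bip c0 hc.
  have h2 := round_diff_le X Y bip' c0 (sensitivity_le_sym hc).
  move: h1 h2; rewrite !ler_norml => /andP[h1 h2] /andP[h3 h4]; apply/andP; split; lra.
Qed.

Lemma act_iter_diff_le K h c t X Y : contracting K -> 0 <= c -> sens h c ->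
  `|act (iter_kernel K t.+1) h X - act (iter_kernel K t.+1) h Y| <=
    #|V|%:R * (rate ^+ t * c).
Proof.
move=> cK; elim: t h c => [|t IH] h c c0 hc.
  have act0 Z : act (iter_kernel K 1) h Z = act K h Z.
    rewrite act_comp /act (bigD1 Z) //= eqxx mul1r [X in _ + X]big1 ?addr0 // => W /negPf.
    by rewrite eq_sym => ->; rewrite mul0r.
  by rewrite expr0 mul1r !act0; apply: contracting_diff.
have := IH (act K h) (rate * c) (mulr_ge0 rate0 c0) (contracting_sens cK c0 hc).
by rewrite -!act_comp [rate ^+ t * _]mulrA -exprSr.
Qed.

(** The two sides of the bipartition can be coloured with one colour each. *)
Lemma uniform_proper_law : is_law pi.
Proof.
have -> : pi = uniform_on R [set Y : col | proper_colouring e Y].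
  by apply/funext => X; rewrite /uniform_on inE.
apply: uniform_on_law; apply/card_gt0P.
have q0 : (0 < q)%N by rewrite (leq_trans _ Dq).
have q1 : (1 < q)%N by rewrite (leq_trans _ Dq) // ltnS.
exists [ffun v => if v \in S then Ordinal q0 else Ordinal q1].
rewrite inE; apply/proper_colouringP => u v uv; rewrite !ffunE.
rewrite -[v \in S]negbK -(bipartition_notin bip) (bipartition_edge bip uv).
by case: (u \in S).
Qed.

Lemma contracting_tv K X t : contracting K ->
  tv_dist (iter_kernel K t.+1 X) pi <= #|V|%:R * rate ^+ t.
Proof.
move=> cK; apply: tv_dist_invariant_le.
- exact: uniform_proper_law.
- exact/invariant_law_iter/contracting_inv.
move=> h h1 Y Z.
rewrite mulrC -mulrA; apply: act_iter_diff_le => //.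
by split; apply: osc_le_bounded; apply: recolour_bounded.
Qed.

End HalfStep.

(** * Mixing times *)

(** From [n * rho ^ t <= eps] one gets [t = (ln n - ln eps) / - ln rho]; dividing by
    [ln 2 <= ln n] turns the terms without [ln n] into multiples of it. *)
Definition mixing_constant (R : realType) (rho eps : R) : R :=
  (1 - ln eps / ln 2) / - ln rho + 2 / ln 2.

Lemma mixing_time_log (R : realType) (T : finType) (K : T -> T -> R) pi (rho eps : R)
  (n : nat) : 0 < rho < 1 -> 0 < eps < 1 -> (1 < n)%N ->
  (forall x t, tv_dist (iter_kernel K t.+1 x) pi <= n%:R * rho ^+ t) ->
  exists t, is_mixing_time K pi eps t /\ t%:R <= mixing_constant rho eps * ln n%:R.
Proof.
move=> /andP[rho0 rho1] /andP[eps0 eps1] n1 tv.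
have n0 : 0 < n%:R :> R by rewrite ltr0n ltnW.
have L0 : 0 < - ln rho by rewrite oppr_gt0 ln_lt0 // rho0.
have ln2 : 0 < ln 2 :> R by rewrite ln_gt0 // ltr1n.
have ln2n : ln 2 <= ln n%:R :> R by rewrite ler_ln ?posrE // ler_nat.
have lneps : ln eps < 0 by rewrite ln_lt0 // eps0.
pose x : R := (ln n%:R - ln eps) / - ln rho.
have x0 : 0 <= x by rewrite divr_ge0 ?(ltW L0) //; lra.
(* one step for rounding up, one because the first step does not contract *)
pose t0 := (Num.truncn x).+2.
have mix0 : mixed_from K pi eps t0.
  move=> y [//|s]; rewrite /t0 ltnS => xs; apply: le_trans (tv y s) _.
  rewrite -ler_ln ?posrE ?mulr_gt0 ?exprn_gt0 // lnM ?posrE ?exprn_gt0 // lnXn //.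
  have : x <= s%:R.
    by apply: le_trans (ltW (truncnS_gt x)) _; rewrite ler_nat.
  by rewrite /x ler_pdivrMr // -[ln rho *+ s]mulr_natl; lra.
have ex : exists t, `[< mixed_from K pi eps t >] by exists t0; apply/asboolP.
have [t /asboolP mt tmin] := ex_minnP ex.
exists t; split; first by split=> // s ms; apply: tmin; apply/asboolP.
apply: le_trans (_ : t0%:R <= _); first by rewrite ler_nat; apply: tmin; apply/asboolP.
have tx : (Num.truncn x)%:R <= x by rewrite truncn_le.
apply: le_trans (_ : x + 2 <= _); first by rewrite /t0 -addn2 natrD lerD2r.
have ratio1 : 1 <= ln n%:R / ln 2 :> R by rewrite ler_pdivlMr // mul1r.
rewrite /mixing_constant [leRHS]mulrDl; apply: lerD.
  rewrite /x mulrAC ler_wpM2r ?invr_ge0 ?(ltW L0) // [leRHS]mulrBl mul1r lerD2l.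
  rewrite lerN2 mulrAC -mulrA -[leRHS]mulr1 ler_wnM2l // ltW //.
by rewrite mulrAC -mulrA -[leLHS]mulr1 ler_wpM2l.
Qed.

Lemma bipartite_mixing (R : realType) (D q : nat) (eps : R) :
  (0 < D)%N -> (D.+1 < q)%N -> D%:R * inv_unused_bound R D.-1 q.-1 < 1 -> 0 < eps < 1 ->
  exists (C : R) (N : nat),
    forall (V : finType) (e : rel V) (V1 V2 : {set V}),
      simple_graph e -> is_bipartition e V1 V2 -> max_degree e = D ->
      (N <= #|V|)%N ->
      (exists t : nat,
         is_mixing_time (scan R e q V1 V2) (uniform_proper R e q) eps t /\
         t%:R <= C * ln (#|V|%:R : R)) /\
      (exists t : nat,
         is_mixing_time (multicolour R e q V1 V2) (uniform_proper R e q) eps t /\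
         t%:R <= C * ln (#|V|%:R : R)).
Proof.
move=> D0 Dq rate1 eps01; set rate := _ * _ in rate1.
have rate0 : 0 < rate.
  rewrite mulr_gt0 ?ltr0n // inv_unused_bound_gt0 // -ltnS !prednK ?(ltnW Dq) //.
  by rewrite (leq_trans _ Dq).
exists (mixing_constant rate eps), 2%N => V e V1 V2 [esym _] bip degD n2.
have deg v : (#|neighbours e v| <= D)%N.
  by rewrite -degD; exact: (leq_bigmax (F := fun v => #|neighbours e v|)).
have mix K : contracting e D V1 V2 K -> exists t,
    is_mixing_time K (uniform_proper R e q) eps t /\
    t%:R <= mixing_constant rate eps * ln #|V|%:R.
  move=> cK; apply: mixing_time_log => // [|X t]; first by rewrite rate0.
  exact: (contracting_tv D0 Dq deg bip).
split; apply: mix.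
  exact: (scan_contracting D0 Dq esym deg (ltW rate1) bip).
exact: (multicolour_contracting D0 Dq esym deg (ltW rate1) bip).
Qed.

(** * The contraction rate is less than 1 *)

Section Numerics.
Variable R : realType.
Implicit Types (D q : nat) (b d : R).

(** [exp (- x) >= (1 - x / 32) ^ 32] at [x = 3 / 5]. *)
Lemma expR_three_fifths : expR (3 / 5 : R) <= 11 / 6.
Proof.
rewrite -[3 / 5]opprK expRN invf_ple ?posrE ?expR_gt0 //.
have step : 1 - 3 / 160 <= expR (- (3 / 160)) :> R by apply: expR_ge1Dx.
have -> : - (3 / 5) = - (3 / 160) * 32%:R :> R by field.
rewrite expRM_natr; apply: le_trans (_ : (1 - 3 / 160) ^+ 32 <= _); last first.
  by rewrite lerXn2r ?nnegrE ?expR_ge0 //; lra.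
have -> : (1 - 3 / 160 : R) ^+ 32 = (((((1 - 3 / 160) ^+ 2) ^+ 2) ^+ 2) ^+ 2) ^+ 2.
  by rewrite -!exprM.
lra.
Qed.

Lemma exists_root_xexp : exists b : R, [/\ b * expR b = 1, 6 / 11 <= b & b <= 3 / 5].
Proof.
have ab : 6 / 11 <= 3 / 5 :> R by lra.
have cont : {within `[(6 / 11 : R), 3 / 5], continuous (fun x : R => x * expR x)}%classic.
  apply: continuous_subspaceT => x; apply: cvgM; first exact: cvg_id.
  exact: continuous_expR.
have lo : 6 / 11 * expR (6 / 11) <= 1 :> R.
  have : expR (6 / 11) <= 11 / 6 :> R.
    by apply: le_trans expR_three_fifths; rewrite ler_expR.
  by lra.
have hi : 1 <= 3 / 5 * expR (3 / 5) :> R.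
  have : 1 + 3 / 5 + (3 / 5) ^+ 2 / 2 <= expR (3 / 5) :> R.
    by apply: expR_ge_quadratic; lra.
  by lra.
have [|b] := IVT ab cont (v := 1).
  by rewrite ge_min lo /= le_max hi orbT.
by rewrite in_itv /= => /andP[h1 h2] h3; exists b.
Qed.

(** Collects all corrections in one exponent, by [1 + x <= exp x]. *)
Lemma rate_lt1 D q b (u v : R) : (0 < D)%N -> (D.+1 < q)%N ->
  let N : R := q%:R - 1 in let m : R := q%:R - D%:R in
  0 < b -> b * expR v <= 1 -> D%:R / N <= b * expR u ->
  u + kappa m * ((D%:R - 1) / N) + N / (4 * m ^+ 2) < v ->
  D%:R * inv_unused_bound R D.-1 q.-1 < 1.
Proof.
move=> D0 Dq N m b0 bv dN tot.
have NE : q.-1%:R = N by rewrite -subn1 natrB // (leq_trans _ Dq).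
have mE : (q.-1 - D.-1)%:R = m.
  rewrite -[q.-1]subn1 -[D.-1]subn1 natrB ?natrB ?(leq_trans _ Dq) //.
  - by rewrite /m; lra.
  - by rewrite leq_sub2r // (leq_trans (leqnSn _)) // ltnW.
have d1 : (D.-1%:R : R) = D%:R - 1 by rewrite -subn1 natrB.
have N0 : 0 < N by rewrite -NE ltr0n -ltnS prednK ?(leq_trans _ Dq).
apply: le_lt_trans (_ : D%:R / N * expR (kappa m * ((D%:R - 1) / N) + N / (4 * m ^+ 2)) < 1).
  rewrite /inv_unused_bound mE NE d1.
  apply: le_trans (_ : D%:R * ((1 + N / (4 * m ^+ 2)) * (N^-1 * expR (kappa m * ((D%:R - 1) / N)))) <= _).
    by rewrite ler_wpM2l // ge_min lexx orbT.
  rewrite [X in _ * X <= _]mulrCA [leLHS]mulrA ler_wpM2l ?divr_ge0 ?(ltW N0) //.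
  by rewrite [leRHS]expRD mulrC ler_wpM2l ?expR_ge0 // expR_ge1Dx.
apply: lt_le_trans bv.
apply: le_lt_trans (_ : b * expR u * expR (kappa m * ((D%:R - 1) / N) + N / (4 * m ^+ 2)) < _).
  by rewrite ler_wpM2r ?expR_ge0.
by rewrite -mulrA ltr_pM2l // -expRD ltr_expR addrA.
Qed.

(** Here the worst case bound [A >= q - D] is enough. *)
Lemma rate_lt1_small D q : (0 < D)%N -> (D.*2 < q)%N ->
  D%:R * inv_unused_bound R D.-1 q.-1 < 1.
Proof.
move=> D0 Dq; have Dm : (D < q.-1 - D.-1)%N by lia.
apply: le_lt_trans (_ : D%:R * (q.-1 - D.-1)%:R^-1 < 1).
  by rewrite ler_wpM2l // ge_min lexx.
by rewrite ltr_pdivrMr ?mul1r ?ltr_nat // ltr0n (leq_ltn_trans _ Dm).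
Qed.

(** The hypotheses of [rate_lt1] with [b = 6 / 11] and [v = 3 / 5], for [N + 1]
    colours. The exponent exceeds [6 / 11] by [O (1 / d)]: a surplus [s = 4] in
    [11 d + s <= 6 q] pays for this from [d = 14] on, none is required from
    [d = 31] on. *)
Lemma exponent_lt (d N s : R) : 1 <= d -> 11 * d + s - 6 <= 6 * N ->
  14 <= d /\ s = 4 \/ 31 <= d /\ s = 0 ->
  d / N <= 6 / 11 * expR ((6 - s) / (11 * d + s - 6)) /\
  (6 - s) / (11 * d + s - 6) + kappa (N + 1 - d) * ((d - 1) / N)
    + N / (4 * (N + 1 - d) ^+ 2) < 3 / 5.
Proof.
move=> d1 dN ds; set m := N + 1 - d; set w := 11 * d + s - 6 in dN *.
have w0 : 0 < w by rewrite /w; case: ds => -[]; lra.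
have N0 : 0 < N by lra.
have m5 : 5 * d + s <= 6 * m by rewrite /m; move: dN; rewrite /w; lra.
have m1 : 1 < m by case: ds => -[]; lra.
have m0 : 0 < m by lra.
have p0 : 0 < 5 * d + s - 6 by case: ds => -[]; lra.
have invN : N^-1 <= 6 / w.
  by rewrite -[6 / w]invf_div lef_pV2 ?posrE ?divr_gt0 //; lra.
split.
  apply: le_trans (_ : 6 / 11 * (1 + (6 - s) / w) <= _).
    apply: le_trans (ler_wpM2l _ invN) _; first by lra.
    have -> : d * (6 / w) = 6 / 11 * (1 + (6 - s) / w); last by [].
    by rewrite /w; field; rewrite gt_eqF.
  by rewrite ler_wpM2l ?expR_ge1Dx.
have yw : (d - 1) / N <= (d - 1) * (6 / w) by rewrite ler_wpM2l //; lra.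
have A : kappa m * ((d - 1) / N) <= kappa m * ((d - 1) * (6 / w)).
  by rewrite ler_wpM2l // addr_ge0 // invr_ge0 mulr_ge0 //; lra.
(* d <= 6 m / 5, hence N = m + d - 1 <= 11 m / 5 *)
have B : N / (4 * m ^+ 2) <= 11 / (20 * m).
  rewrite ler_pdivrMr ?mulr_gt0 ?exprn_gt0 //.
  have -> : 11 / (20 * m) * (4 * m ^+ 2) = 11 / 5 * m by field; rewrite gt_eqF.
  by rewrite /m; case: ds => -[]; move: dN; rewrite /w; lra.
apply: le_lt_trans (lerD (lerD (lexx _) A) B) _.
have k1 : (2 * (m - 1))^-1 <= 3 / (5 * d + s - 6).
  by rewrite -[3 / _]invf_div lef_pV2 ?posrE; lra.
have m' : 11 / (20 * m) <= 33 / (10 * (5 * d + s)).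
  rewrite ler_pdivrMr ?mulr_gt0 // mulrAC ler_pdivlMr; lra.
have C : kappa m * ((d - 1) * (6 / w)) <=
    (1 + 3 / (5 * d + s - 6)) * ((d - 1) * (6 / w)).
  rewrite ler_wpM2r /kappa ?lerD2l // mulr_ge0 ?divr_ge0 //; lra.
apply: le_lt_trans (lerD (lerD (lexx _) C) m') _.
have -> : (6 - s) / w + (1 + 3 / (5 * d + s - 6)) * ((d - 1) * (6 / w)) =
    6 / 11 + ((36 - 17 * s) / 11 + 18 * (d - 1) / (5 * d + s - 6)) / w.
  by rewrite /w; field; rewrite !gt_eqF.
have tail : 18 * (d - 1) / (5 * d + s - 6) <= 37 / 10.
  by rewrite ler_pdivrMr //; case: ds => -[]; lra.
case: ds => -[dd se].
  have c1 : 33 / (10 * (5 * d + s)) <= 33 / 740.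
    by rewrite ler_pM2l // lef_pV2 ?posrE; lra.
  have c2 : ((36 - 17 * s) / 11 + 18 * (d - 1) / (5 * d + s - 6)) / w <= 4 / 5 / w.
    by rewrite ler_pM2r ?invr_gt0 //; lra.
  have w152 : 152 <= w by rewrite /w; lra.
  have c3 : 4 / 5 / w <= 4 / 5 / 152 by rewrite ler_pdivrMr //; lra.
  lra.
have c1 : 33 / (10 * (5 * d + s)) <= 33 / 1550.
  by rewrite ler_pM2l // lef_pV2 ?posrE; lra.
have c2 : ((36 - 17 * s) / 11 + 18 * (d - 1) / (5 * d + s - 6)) / w <= 7 / w.
  by rewrite ler_pM2r ?invr_gt0 //; lra.
have w335 : 335 <= w by rewrite /w; lra.
have c3 : 7 / w <= 7 / 335 by rewrite ler_pdivrMr //; lra.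
lra.
Qed.

Lemma rate_lt1_eleven_sixths D q (s : nat) : (11 * D + s <= 6 * q)%N ->
  (14 <= D)%N /\ s = 4%N \/ (31 <= D)%N /\ s = 0%N ->
  D%:R * inv_unused_bound R D.-1 q.-1 < 1.
Proof.
move=> Dq Ds.
have dq : 11 * D%:R + s%:R <= 6 * q%:R :> R by rewrite -!natrM -natrD ler_nat.
have d1 : 1 <= D%:R :> R by rewrite ler1n; lia.
have ds : 14 <= D%:R :> R /\ s%:R = 4 :> R \/ 31 <= D%:R :> R /\ s%:R = 0 :> R.
  by case: Ds => -[D1 ->]; [left | right]; rewrite ler_nat.
have [] := @exponent_lt D%:R (q%:R - 1) s%:R d1 _ ds; first by lra.
rewrite subrK => h1 h2.
apply: (@rate_lt1 _ _ (6 / 11) _ (3 / 5) _ _ _ _ h1 h2); first by lia.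
- by lia.
- by lra.
- by have := expR_three_fifths; lra.
Qed.

(** [b ^-1] is the asymptotic number of colours per neighbour; four more colours
    than [D / b] outweigh the lower order terms. *)
Lemma rate_lt1_asymptotic D q b : b * expR b = 1 -> b <= 3 / 5 -> (31 <= D)%N ->
  D%:R / b + 4 <= q%:R -> D%:R * inv_unused_bound R D.-1 q.-1 < 1.
Proof.
move=> bb b35 D31 Dq.
have b0 : 0 < b by rewrite -(pmulr_lgt0 _ (expR_gt0 b)) bb.
set N : R := q%:R - 1.
have d31 : 31 <= D%:R :> R by rewrite ler_nat.
have dN : D%:R <= b * (N - 3).
  by rewrite mulrC -ler_pdivrMr // /N; lra.
have N0 : 3 < N.
  by rewrite -subr_gt0 -(pmulr_rgt0 _ b0); lra.
have dN35 : D%:R <= 3 / 5 * (N - 3).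
  by apply: le_trans dN _; rewrite ler_wpM2r //; lra.
have dNb : D%:R / N <= b * (1 - 3 / N).
  rewrite ler_pdivrMr; last by lra.
  by rewrite -mulrA mulrBl mul1r divfK // gt_eqF; lra.
set m : R := q%:R - D%:R.
have mN : 2 / 5 * N <= m - 1 by rewrite /m; move: dN35; rewrite /N; lra.
apply: (@rate_lt1 _ _ b (- (3 / N)) b); rewrite -/N -/m ?bb //.
- by lia.
- rewrite -(ltr_nat R) -addn1 natrD; move: dN35; rewrite /N; lra.
- by apply: le_trans dNb _; rewrite ler_pM2l // expR_ge1Dx.
have y_le : (D%:R - 1) / N <= b * (1 - 3 / N).
  by apply: le_trans dNb; rewrite ler_pM2r ?invr_gt0; lra.
have N3 : 0 < 3 / N by rewrite divr_gt0 //; lra.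
have y_le' : (D%:R - 1) / N <= b.
  by apply: le_trans y_le _; rewrite ger_pMr //; lra.
have y0 : 0 <= (D%:R - 1) / N by rewrite divr_ge0; lra.
have k : (2 * (m - 1))^-1 * ((D%:R - 1) / N) <= 3 / 4 / N.
  apply: le_trans (_ : (4 / 5 * N)^-1 * (3 / 5) <= _).
    have y35 := le_trans y_le' b35.
    apply: ler_pM => //; first by rewrite invr_ge0; lra.
    by rewrite lef_pV2 ?posrE; lra.
  by rewrite le_eqVlt; apply/orP; left; apply/eqP; field; rewrite gt_eqF //; lra.
have v : N / (4 * m ^+ 2) <= 25 / 16 / N.
  have mm : (2 / 5 * N) ^+ 2 <= m ^+ 2 by rewrite lerXn2r ?nnegrE; lra.
  rewrite ler_pdivrMr; last by rewrite mulr_gt0 ?exprn_gt0 //; lra.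
  rewrite mulrAC ler_pdivlMr; last by lra.
  by rewrite -expr2; move: mm; rewrite exprMn; lra.
have b1 : b * (3 / N) >= 0 by rewrite mulr_ge0 // ltW.
rewrite /kappa mulrDl mul1r.
have : 3 / 4 / N + 25 / 16 / N < 3 / N.
  by rewrite -mulrDl ltr_pM2r ?invr_gt0; lra.
lra.
Qed.

End Numerics.

(** * The threshold *)

(** The ranges follow the available estimates: [rate_lt1_small] for [D < 14], and
    [rate_lt1_eleven_sixths] from there on, with surplus 4 up to [D = 30] (the
    value at 22 is then 40) and without surplus afterwards, where it competes
    with [rate_lt1_asymptotic]. *)
Definition threshold (R : realType) (b : R) (D : nat) : nat :=
  if (D < 14)%N then D.*2 else
  if (D < 31)%N then ((11 * D + 3) %/ 6)%N else
  minn ((11 * D - 1) %/ 6) (Num.truncn (D%:R / b) + 4).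

Section Threshold.
Variables (R : realType) (b : R).
Hypothesis bb : b * expR b = 1.
Hypothesis b_lo : 6 / 11 <= b.
Hypothesis b_hi : b <= 3 / 5.

Let b0 : 0 < b. Proof. by apply: lt_le_trans b_lo. Qed.

Local Notation f := (threshold b).

Lemma threshold_rate (D q : nat) : (0 < D)%N -> (f D < q)%N ->
  (D.+1 < q)%N /\ D%:R * inv_unused_bound R D.-1 q.-1 < 1.
Proof.
rewrite /threshold => D0; have [D14|D14] := ltnP D 14.
  by move=> h; split; [lia | apply: rate_lt1_small].
have [D31|D31] := ltnP D 31.
  move=> h; split; first by lia.
  by apply: (@rate_lt1_eleven_sixths _ _ _ 4); [lia | left].
rewrite gtn_min => /orP[h|h].
  split; first by lia.
  by apply: (@rate_lt1_eleven_sixths _ _ _ 0); [lia | right].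
have Db : D%:R / b + 4 <= q%:R.
  have := truncnS_gt (D%:R / b).
  have : ((Num.truncn (D%:R / b)).+1%:R + 4 <= q%:R :> R).
    by rewrite -natrD ler_nat addSn.
  clear h; lra.
split; last exact: (rate_lt1_asymptotic bb).
clear h.
have d31 : 31 <= D%:R :> R by rewrite ler_nat.
have : D%:R <= D%:R / b.
  by rewrite ler_pdivlMr // ler_piMr // (le_trans b_hi) //; lra.
move=> h1; rewrite -(ltr_nat R) -addn1 natrD; lra.
Qed.

Lemma threshold_large (D : nat) : (31 <= D)%N ->
  f D = minn ((11 * D - 1) %/ 6) (Num.truncn (D%:R / b) + 4).
Proof. by move=> D31; rewrite /threshold !ifF //; lia. Qed.

Lemma threshold_le_ceil (D : nat) : (14 <= D)%N ->
  (f D)%:Z <= Num.ceil (11 * D%:R / 6 : R).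
Proof.
move=> D14; rewrite -ltzD1 -ltrBlDr ceil_gt_int intrD /= -pmulrn.
have : (6 * f D <= 11 * D + 3)%N.
  have [D31|D31] := ltnP D 31.
    by rewrite /threshold D31 ifF; lia.
  rewrite threshold_large //.
  by have := geq_minl ((11 * D - 1) %/ 6) (Num.truncn (D%:R / b) + 4); lia.
rewrite -(ler_nat R) natrD !natrM; lra.
Qed.

Lemma threshold_lt_ceil (D : nat) : (31 <= D)%N ->
  (f D)%:Z < Num.ceil (11 * D%:R / 6 : R).
Proof.
move=> D31; rewrite ceil_gt_int -pmulrn.
have : (6 * f D < 11 * D)%N.
  rewrite threshold_large //.
  by have := geq_minl ((11 * D - 1) %/ 6) (Num.truncn (D%:R / b) + 4); lia.
rewrite -(ltr_nat R) !natrM; lra.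
Qed.

Lemma threshold_cvg : ((fun D : nat => (f D)%:R / D%:R : R) @ \oo --> b^-1)%classic.
Proof.
apply/cvgrPdist_le => eps eps0.
exists (maxn 31 (Num.truncn (4 / eps)).+1) => // D /=; rewrite geq_max => /andP[D31 De].
have d31 : 31 <= D%:R :> R by rewrite ler_nat.
have d0 : 0 < D%:R :> R by lra.
have e4 : 4 <= eps * D%:R.
  rewrite mulrC -ler_pdivrMr // (le_trans (ltW (truncnS_gt _))) // ler_nat //.
have -> : b^-1 - (f D)%:R / D%:R = (D%:R / b - (f D)%:R) / D%:R.
  by field; rewrite !gt_eqF.
rewrite normrM normfV (gtr0_norm d0) ler_pdivrMr //; apply: le_trans e4.
have x0 : 0 <= D%:R / b by rewrite divr_ge0 // ltW.
have t1 : (Num.truncn (D%:R / b))%:R <= D%:R / b by rewrite truncn_le.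
have t2 := truncnS_gt (D%:R / b).
have h1 : D%:R / b <= 11 / 6 * D%:R.
  by rewrite ler_pdivrMr // mulrAC -[leLHS]mul1r ler_pM2r //; move: b_lo; lra.
have g1 : (11 * D%:R - 6 <= 6 * ((11 * D - 1) %/ 6)%:R :> R).
  rewrite lerBlDr -!natrM -natrD ler_nat; lia.
rewrite threshold_large // -minEnat natr_min natrD ler_norml minEle.
by move: t2; rewrite -natr1; case: ifP => h t2; apply/andP; split; lra.
Qed.

End Threshold.

Local Open Scope classical_set_scope.
Local Open Scope ring_scope.

Theorem theorem6p1 (R : realType) :
  exists (beta : R) (f : nat -> nat),
    (beta^-1 * expR (beta^-1) = 1 /\
     ((fun D : nat => (f D)%:R / D%:R : R) @ \oo --> beta)) /\
    (forall D : nat, (14 <= D)%N ->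
       (f D)%:Z <= Num.ceil (11 * D%:R / 6 : R)) /\
    (forall D : nat, (31 <= D)%N ->
       (f D)%:Z < Num.ceil (11 * D%:R / 6 : R)) /\
    (f 22%N = 40%N /\ 40%:Z < Num.ceil (11 * 22 / 6 : R)) /\
    forall (D q : nat) (eps : R),
      (0 < D)%N -> (f D < q)%N -> 0 < eps < 1 ->
      exists (C : R) (N : nat),
        forall (V : finType) (e : rel V) (V1 V2 : {set V}),
          simple_graph e -> is_bipartition e V1 V2 -> max_degree e = D ->
          (N <= #|V|)%N ->
          (exists t : nat,
             is_mixing_time (scan R e q V1 V2) (uniform_proper R e q) eps t /\
             t%:R <= C * ln (#|V|%:R : R)) /\
          (exists t : nat,
             is_mixing_time (multicolour R e q V1 V2) (uniform_proper R e q)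
               eps t /\
             t%:R <= C * ln (#|V|%:R : R)).

Proof.
have [b [bb b_lo b_hi]] := exists_root_xexp R.
exists b^-1, (threshold b); split.
  by rewrite invrK; split=> //; apply: threshold_cvg.
split; first by move=> D; apply: threshold_le_ceil.
split; first by move=> D; apply: threshold_lt_ceil.
split; first by split=> //; rewrite ceil_gt_int; lra.
move=> D q eps D0 fq eps01.
have [Dq rate1] := threshold_rate bb b_lo b_hi D0 fq.
exact: bipartite_mixing.
Qed.
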